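(* Let $K:S\times S\to\mathbb{R}$ be a positive definite kernel on a set $S$, with reproducing kernel Hilbert space $\mathscr{H}(K)$. Then the isometry $T_K:\mathscr{L}_2(K)\to\mathscr{H}(K)$ maps $\mathscr{L}_2(K)$ onto $\mathscr{H}(K)$.
   Context: $K:S\times S\to\mathbb{R}$ positive definite (p.d.) means $K$ is symmetric and $\sum_i\sum_j c_ic_jK(s_i,s_j)\ge 0$ for all finite families $c_i\in\mathbb{R}$, $s_i\in S$. $\mathscr{H}(K)$ is the associated (real) RKHS of functions on $S$, with $\langle K(\cdot,t),G\rangle_{\mathscr{H}(K)}=G(t)$. $\mathscr{L}_2(K)$ is the set of linear functionals $l:\mathscr{H}(K)\to\mathbb{R}$ for which there is a constant $C_l<\infty$ with $|l(G)|\le C_l\|G\|_{\mathscr{H}(K)}$ for all $G\in\mathscr{H}(K)$. It carries the Hilbert inner product determined by $\langle l,l\rangle_{\mathscr{L}_2}=lKl:=l(\text{acting in }s)\,K(s,t)\,l(\text{acting in }t)$, i.e. $l$ is applied to $K(s,t)$ in the variable $s$, and then $l$ is applied to the resulting function of $t$. For $l\in\mathscr{L}_2(K)$, $T_K(l):=F_l$, where $F_l\in\mathscr{H}(K)$ is the unique element (Riesz) with $l(G)=\langle F_l,G\rangle_{\mathscr{H}(K)}$ for all $G\in\mathscr{H}(K)$; equivalently $(T_Kl)(t)=l(K(\cdot,t))$. *)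

(* Defs.v *)
From HB Require Import structures.
From mathcomp Require Import all_boot all_order all_algebra.
From mathcomp Require Import all_classical all_reals all_analysis.

Set Implicit Arguments.
Unset Strict Implicit.
Unset Printing Implicit Defensive.

Import Order.TTheory GRing.Theory Num.Theory.
Import numFieldNormedType.Exports.

Local Open Scope ring_scope.

Definition positive_definite (R : realType) (S : Type) (K : S -> S -> R) :=
  (forall s t, K s t = K t s) /\
  (forall (n : nat) (c : 'I_n -> R) (s : 'I_n -> S),
     0 <= \sum_(i < n) \sum_(j < n) c i * c j * K (s i) (s j)).

(* A Hilbert space of functions on S with reproducing kernel K; by
   Moore-Aronszajn it exists as soon as K is positive definite, and is then
   unique.  The library has no Hilbert space structure: it is given here as a
   complete normed space whose norm comes from an inner product.  Its elements
   are functions on S through the injective linear map [rkhs_eval]; the element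
   [rkhs_section t] is the function K(., t). *)
Record rkhs (R : realType) (S : Type) (K : S -> S -> R) := Rkhs {
  rkhs_space :> completeNormedModType R ;
  rkhs_dot : {dot rkhs_space for idfun} ;
  rkhs_dot_norm : forall F, rkhs_dot F F = `|F| ^+ 2 ;
  rkhs_eval : {linear rkhs_space -> (S -> R^o)} ;
  rkhs_eval_inj : injective rkhs_eval ;
  rkhs_section : S -> rkhs_space ;
  rkhs_eval_section : forall t, rkhs_eval (rkhs_section t) = K^~ t ;
  rkhs_reproducing : forall t G, rkhs_dot (rkhs_section t) G = rkhs_eval G t }.

Section BoundedFunctionals.
Variables (R : realType) (S : Type) (K : S -> S -> R) (H : rkhs K).

Definition bounded_functional : {pred H -> R^o} :=
  fun l => `[< linear l /\ exists C : R, forall G, `|l G| <= C * `|G| >].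

Lemma bounded_functional_submod : submod_closed bounded_functional.
Proof.
split=> [|a l m /asboolP[lL [C lC]] /asboolP[mL [D mD]]]; apply/asboolP; split.
- by move=> b F G; rewrite /= scaler0 addr0.
- by exists 0 => G; rewrite normr0 mul0r.
- move=> b F G; rewrite !fctE lL mL !scalerDr !scalerA (mulrC a b) -!addrA.
  by congr (_ + _); rewrite addrCA.
- exists (`|a| * C + D) => G; rewrite mulrDl.
  rewrite (le_trans (ler_normD _ _)) ?lerD //.
  by rewrite normrZ -mulrA ler_wpM2l.
Qed.

HB.instance Definition _ := GRing.isSubmodClosed.Build R (H -> R^o)
  bounded_functional bounded_functional_submod.

Record L2 := MkL2 { L2_fun :> H -> R^o ; _ : L2_fun \in bounded_functional }.

HB.instance Definition _ := [isSub for L2_fun].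
HB.instance Definition _ := [Choice of L2 by <:].
HB.instance Definition _ := [SubChoice_isSubLmodule of L2 by <:].

End BoundedFunctionals.

Section Isometry.
Variables (R : realType) (S : Type) (K : S -> S -> R) (H : rkhs K).

(* The element of H that is the function g, and 0 if g is not in H. *)
Definition rkhs_of_fun (g : S -> R) : H :=
  xget 0 [set F : H | rkhs_eval H F = g]%classic.

(* lKm: l acts on K(s, t) in s, then m acts on the resulting function of t,
   which does belong to H.  The form is bilinear and symmetric, so it is the
   inner product whose quadratic form is lKl. *)
Definition L2_dot (l m : L2 H) : R :=
  m (rkhs_of_fun (fun t => l (rkhs_section H t))).

(* The Riesz representative of l; the default value 0 is never used. *)
Definition T_K (l : L2 H) : H :=
  xget 0 [set F : H | forall G, l G = rkhs_dot H F G]%classic.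

End Isometry.

(* Main.v *)
Require Import Defs.
From HB Require Import structures.
From mathcomp Require Import all_boot all_order all_algebra.
From mathcomp Require Import all_classical all_reals all_analysis.
From mathcomp Require Import ring lra.
Import Order.TTheory GRing.Theory Num.Theory.
Import numFieldNormedType.Exports.
Local Open Scope ring_scope.

(** The map [T_K] sends a bounded functional to its Riesz representative, so it
    is onto because, by Cauchy-Schwarz, every F represents the bounded
    functional [G |-> <F, G>]; its linearity follows from uniqueness of the
    representative.  It is an isometry because [T_K l] is, as a function of t,
    equal to [l K(., t)]: applying m to that function gives
    [m (T_K l) = <T_K m, T_K l>].

    The work is in the existence of a representative (lemma [riesz]).  It is the
    minimizer of [J F = |F|^2 - 2 l F], but it is reached here without showing
    that J is continuous or that its infimum is attained.  If J F is within e^2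
    of the infimum, then comparing F with the points F + t G already gives
    [|<F, G> - l G| <= e |G|] for all G (lemma [approx_riesz]).  Two such
    approximate representatives F and F' are close, as one sees by testing them
    on G = F - F' (lemma [approx_riesz_close]).  Hence approximate
    representatives with e tending to 0 form a Cauchy sequence, and its limit is
    an exact representative. *)

(** * The Riesz representation theorem in a complete real inner product space *)

Section Riesz.
Set Implicit Arguments.
Unset Strict Implicit.
Variables (R : realType) (E : completeNormedModType R).
Variables (dot : {dot E for idfun}) (dot_norm : forall F, dot F F = `|F| ^+ 2).

Lemma dotC F G : dot F G = dot G F.
Proof. by rewrite hermC expr0 mul1r. Qed.

(** The norm being given, Cauchy-Schwarz is the triangle inequality, squared. *)
Lemma dot_le_norm F G : dot F G <= `|F| * `|G|.
Proof.
have sqD : `|F + G| ^+ 2 = `|F| ^+ 2 + 2 * dot F G + `|G| ^+ 2.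
  by rewrite -!dot_norm linearDl !linearDr /= (dotC G F); ring.
have : `|F + G| ^+ 2 <= (`|F| + `|G|) ^+ 2.
  by rewrite lerXn2r ?nnegrE ?addr_ge0 ?ler_normD.
by rewrite sqD; nra.
Qed.

Lemma norm_dot_le F G : `|dot F G| <= `|F| * `|G|.
Proof.
by rewrite ler_norml dot_le_norm andbT lerNl -linearNl -(normrN F) dot_le_norm.
Qed.

Lemma dot_inj F F' : (forall G, dot F G = dot F' G) -> F = F'.
Proof.
move=> eqF; apply/eqP; rewrite -subr_eq0 -normr_eq0 -sqrf_eq0 -dot_norm.
by rewrite linearBl /= eqF subrr.
Qed.

Variables (l : {linear E -> R^o}) (C : R).
Hypothesis l_bounded : forall G, `|l G| <= C * `|G|.

(** A near-minimizer of J is an approximate representative: with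
    [d = <F, G> - l G] one has [J (F + t G) = J F + 2 t d + t^2 |G|^2], whose
    least value over t is [J F - d^2 / |G|^2].  If J F exceeds the infimum by at
    most e^2, this forces [d^2 <= e^2 |G|^2]. *)
Lemma approx_riesz (e : R) : 0 < e ->
  exists F, forall G, `|dot F G - l G| <= e * `|G|.
Proof.
move=> e0; pose J F : R := `|F| ^+ 2 - 2 * l F.
have J_lb F : - C ^+ 2 <= J F.
  have := le_trans (ler_norm _) (l_bounded F); have := sqr_ge0 (`|F| - C).
  by rewrite /J; nra.
have J_inf : has_inf (range J).
  by split; [exists (J 0); exists 0 | exists (- C ^+ 2) => _ [F _ <-]].
have [_ [F _ <-] JF_lt] := inf_adherent (exprn_gt0 2 e0) J_inf.
exists F => G.
have [->|G0] := eqVneq G 0.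
  by rewrite linear0r linear0 subrr !normr0 mulr0.
have nG0 : 0 < `|G| by rewrite normr_gt0.
(* t is the point where the quadratic polynomial t |-> J (F + t G) is least *)
pose d := dot F G - l G; pose t := - (d / `|G| ^+ 2).
have JE : J (F + t *: G) = J F + 2 * t * d + t ^+ 2 * `|G| ^+ 2.
  rewrite /J /d -!dot_norm linearDl !linearDr /= !linearZl_LR !linearZr_LR /=.
  by rewrite (dotC G F) !linearD !linearZ /= /GRing.scale /=; ring.
have : J F - e ^+ 2 <= J (F + t *: G).
  rewrite lerBlDr ltW// (lt_le_trans JF_lt)// lerD2r.
  by apply: ge_inf; [case: J_inf | exists (F + t *: G)].
have -> : J (F + t *: G) = J F - d ^+ 2 / `|G| ^+ 2.
  by rewrite JE /t; field; rewrite gt_eqF.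
rewrite lerD2l lerN2 ler_pdivrMr ?exprn_gt0// -exprMn -real_normK ?num_real//.
by rewrite ler_pXn2r ?nnegrE// mulr_ge0// ltW.
Qed.

(** Testing both inequalities on [G = F - F'] and subtracting them gives
    [|F - F'|^2 <= (e + e') |F - F'|]. *)
Lemma approx_riesz_close (F F' : E) (e e' : R) :
  0 <= e -> 0 <= e' ->
  (forall G, `|dot F G - l G| <= e * `|G|) ->
  (forall G, `|dot F' G - l G| <= e' * `|G|) -> `|F - F'| <= e + e'.
Proof.
move=> e0 e'0 /(_ (F - F')) HF /(_ (F - F')) HF'.
have [/eqP ->|n0] := boolP (`|F - F'| == 0); first exact: addr_ge0.
have : `|F - F'| ^+ 2 <= (e + e') * `|F - F'|.
  rewrite -dot_norm linearBl /= mulrDl.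
  by move: HF HF'; rewrite !ler_norml => /andP[_ HF] /andP[HF' _]; lra.
by rewrite expr2 ler_pM2r// lt_def n0 normr_ge0.
Qed.

(** The representative is a limit of approximate ones; the relation
    [<F, G> = l G] passes to the limit because [<., G>] is continuous, by
    Cauchy-Schwarz. *)
Lemma riesz : exists F, forall G, l G = dot F G.
Proof.
have h0 n : 0 < n.+1%:R^-1 :> R by rewrite invr_gt0.
have [f fP] := choice (fun n => approx_riesz (h0 n)).
have f_cauchy : cauchy (f @ \oo)%classic.
  apply: cauchy_exP => _/posnumP[e].
  have [N _ NP] := near_infty_natSinv_lt (e%:num / 2)%:pos.
  exists (f N); exists N => // n /= Nn; rewrite /= -ball_normE /=.
  apply: le_lt_trans (approx_riesz_close _ _ (fP N) (fP n)) _; rewrite ?ltW//.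
  by rewrite (splitr e%:num) ltrD//; [exact: NP (leqnn N) | exact: NP Nn].
have /cvgrPdist_le f_cvg : (f @ \oo --> lim (f @ \oo))%classic.
  exact: cauchy_cvg.
exists (lim (f @ \oo)%classic) => G; set F := lim _ in f_cvg *.
apply/esym/eqP; rewrite -subr_eq0 -normr_le0.
apply/ler_addgt0Pr => e e0; rewrite add0r.
(* |G| + 1 rather than |G|, so as not to divide by 0 *)
pose d := e / (2 * (`|G| + 1)).
have d0 : 0 < d by rewrite divr_gt0// mulr_gt0// ltr_wpDl.
have [n /= [Fn hn]] : exists n, `|F - f n| <= d /\ n.+1%:R^-1 < d.
  near (\oo%classic : set_system nat) => n; exists n; split; near: n.
  - exact: f_cvg.
  - exact: (near_infty_natSinv_lt (PosNum d0)).
have -> : dot F G - l G = dot (F - f n) G + (dot (f n) G - l G).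
  by rewrite linearBl /= addrA subrK.
rewrite (le_trans (ler_normD _ _))//.
have -> : e = d * (`|G| + 1) + d * (`|G| + 1).
  by rewrite /d; field; rewrite gt_eqF// ltr_wpDl.
have dG : d * `|G| <= d * (`|G| + 1) by rewrite ler_pM2l// lerDl.
rewrite lerD// (le_trans _ dG)//.
- by rewrite (le_trans (norm_dot_le _ _))// ler_wpM2r.
- by rewrite (le_trans (fP n G))// ler_wpM2r// ltW.
Unshelve. all: by end_near. Qed.

End Riesz.

(** * Riesz representatives in a reproducing kernel Hilbert space *)

Section Isometry.
Set Implicit Arguments.
Unset Strict Implicit.
Variables (R : realType) (S : Type) (K : S -> S -> R) (H : rkhs K).

Lemma L2_linear (l : L2 H) : linear l.
Proof. by case: l => f /= /asboolP[]. Qed.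

(** [T_K l] is chosen among the representatives of l, and [riesz] provides
    one. *)
Lemma T_KP (l : L2 H) (G : H) : l G = rkhs_dot H (T_K l) G.
Proof.
have [C lC] : exists C : R, forall G, `|l G| <= C * `|G|.
  by case: l => f /= /asboolP[].
pose l_lin := GRing.isLinear.Build R H R^o *:%R l (L2_linear l).
pose l' : {linear H -> R^o} := HB.pack (l : H -> R^o) l_lin.
have /(xgetPex 0) := riesz (@rkhs_dot_norm _ _ _ H) (l := l') lC.
exact.
Qed.

Lemma T_K_unique (l : L2 H) (F : H) :
  (forall G, l G = rkhs_dot H F G) -> T_K l = F.
Proof.
by move=> lF; apply: (dot_inj (@rkhs_dot_norm _ _ _ H)) => G; rewrite -T_KP.
Qed.

Lemma rkhs_of_funK (F : H) : rkhs_of_fun H (rkhs_eval H F) = F.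
Proof.
apply: rkhs_eval_inj.
apply: (@xgetPex _ 0 [set G : H | rkhs_eval H G = rkhs_eval H F]%classic).
by exists F.
Qed.

(** This identity, the reproducing property read through [T_K], is what makes
    the iterated action [lKm] meaningful: [t |-> l K(., t)] is the function of
    an element of the space. *)
Lemma T_K_eval (l : L2 H) t : rkhs_eval H (T_K l) t = l (rkhs_section H t).
Proof. by rewrite -rkhs_reproducing dotC -T_KP. Qed.

Lemma dot_bounded (F : H) : rkhs_dot H F \in @bounded_functional R S K H.
Proof.
apply/asboolP; split; first by move=> a G G'; rewrite linearPr.
by exists `|F| => G; exact: (norm_dot_le (@rkhs_dot_norm _ _ _ H)).
Qed.

End Isometry.

Theorem theorem2p25 (R : realType) (S : Type) (K : S -> S -> R)
    (K_pd : positive_definite K) (H : rkhs K) :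
  [/\ forall (l : L2 H) (G : H), l G = rkhs_dot H (T_K l) G,
      linear (@T_K _ _ K H),
      forall l m : L2 H, rkhs_dot H (T_K l) (T_K m) = L2_dot l m
    & forall F : H, exists l : L2 H, T_K l = F].
Proof.
split; first exact: T_KP.
- by move=> a l m; apply: T_K_unique => G; rewrite linearPl /= -!T_KP.
- move=> l m; rewrite /L2_dot dotC -T_KP.
  have -> : (fun t => l (rkhs_section H t)) = rkhs_eval H (T_K l).
    by apply/funext => t; rewrite T_K_eval.
  by rewrite rkhs_of_funK.
- by move=> F; exists (MkL2 (dot_bounded F)); exact: T_K_unique.
Qed.
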